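(* Let $E=\{n_k\}_{k\ge1}\subseteq\mathbb{Z}$ and $q>\sqrt{\pi^2/2+1}$. If $|n_{k+1}|\ge q|n_k|$ for all $k$, then the Sidon constant of $E$ is at most $1+\pi^2/(2q^2-2-\pi^2)$.
   Context: $\mathbb{T}=\{z\in\mathbb{C}:|z|=1\}$; $e_n(z)=z^n$. The $n_k$ are distinct. The Sidon constant of $E$ is the infimum of the $C$ such that $\sum_{j\in G}|a_j|\le C\sup_{z\in\mathbb{T}}|\sum_{j\in G}a_je_j(z)|$ for all finite $G\subseteq E$ and $a_j\in\mathbb{C}$. *)

(* Defs.v *)
From HB Require Import structures.
From mathcomp Require Import all_boot all_order all_algebra finmap complex.
From mathcomp Require Import all_classical all_reals all_analysis.

Set Implicit Arguments.
Unset Strict Implicit.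
Unset Printing Implicit Defensive.

Import Order.TTheory GRing.Theory Num.Theory.

Local Open Scope classical_set_scope.
Local Open Scope ring_scope.
Local Open Scope complex_scope.

Section Sidon.
Variable R : realType.
Implicit Types (E : set int) (G : {fset int}) (a : int -> R[i]).

Definition unit_circle : set R[i] := [set z | `|z| = 1].

Definition trig_poly G a (z : R[i]) : R[i] := \sum_(j <- G) a j * z ^ j.

(* [sup] is 0 on sets without a least upper bound; for f continuous, in
   particular for trigonometric polynomials, the set below is nonempty and
   bounded, so this is the true supremum norm. *)
Definition sup_circle (f : R[i] -> R[i]) : R :=
  sup [set Normc.normc (f z) | z in unit_circle].

(* An infimum in the extended reals: it is +oo if no constant is admissible.
   The sign of C is left free; this matters only for the empty set, whose
   Sidon constant is then -oo. *)
Definition sidon_constant E : \bar R :=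
  ereal_inf [set C%:E | C in [set C : R |
    forall G a, [set` G] `<=` E ->
      \sum_(j <- G) Normc.normc (a j) <= C * sup_circle (trig_poly G a)]].

End Sidon.

(* Main.v *)
(* Let w be the polynomial rotated so that its first coefficient is
   nonnegative (the first frequency may be 0, and then no choice of t changes
   that phase).  Set t_0 = 0 and choose t_{k+1} among the two neighbours of t_k
   at which the (k+1)-st term of w is real and nonnegative; these are
   2 pi / |n_{k+1}| apart.  Choosing at random so that the mean is t_k adds
   variance at most pi^2 / n_{k+1}^2, so the errors add up in squares:
   E (t_m - t_k)^2 <= sum_{i > k} pi^2 / n_i^2 <= pi^2 / (n_k^2 (q^2 - 1)).
   With cos x >= 1 - x^2 / 2 this gives
   E Re w(t_m) >= (1 - pi^2 / (2 (q^2 - 1))) sum |a_k|.  The expectation is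
   replaced by a greedy choice, keeping the weighted sum of squares below its
   mean. *)
Require Import Defs.
From HB Require Import structures.
From mathcomp Require Import all_boot all_order all_algebra finmap complex.
From mathcomp Require Import all_classical all_reals all_analysis.
From mathcomp Require Import ring lra.

Set Implicit Arguments.
Unset Strict Implicit.
Unset Printing Implicit Defensive.

Import Order.TTheory GRing.Theory Num.Theory.
Import numFieldNormedType.Exports.

Local Open Scope classical_set_scope.
Local Open Scope ring_scope.

(** * Real trigonometry, polar form, and the grids where a single term is real and nonnegative *)

Section RealTrigonometry.
Variable R : realType.
Implicit Types (x y t : R).

Lemma norm_sin_le_norm x : `|sin x| <= `|x|.
Proof.
suff sin_le (y : R) : 0 <= y -> `|sin y| <= y.
  have [x0|x0] := leP 0 x; first by rewrite (ger0_norm x0) sin_le.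
  by rewrite -normrN -sinN -[leRHS]normrN [leRHS]ger0_norm ?sin_le; lra.
move=> y0.
have [|c _] := @MVT_segment R sin cos _ _ y0.
  exact/continuous_subspaceT/continuous_sin.
rewrite sin0 !subr0 => ->; rewrite normrM (ger0_norm y0) ler_piMl //.
exact: cos_max.
Qed.

(** By the half-angle formula, [cos x] is [1 - 2 * sin (x / 2) ^+ 2]. *)
Lemma cos_ge_quadratic x : 1 - x ^+ 2 / 2 <= cos x.
Proof.
rewrite {2}[x]splitr cosD; have := cos2Dsin2 (x / 2).
have : sin (x / 2) ^+ 2 <= (x / 2) ^+ 2.
  rewrite -[leLHS]real_normK ?num_real// -[leRHS]real_normK ?num_real//.
  by rewrite lerXn2r ?nnegrE// norm_sin_le_norm.
by move: (sin _) (cos _) => S C; lra.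
Qed.

Lemma cos_period_int (z : int) x : cos (x + z%:~R * (pi *+ 2)) = cos x.
Proof.
have cosnat m y : cos (y + m%:R * (pi *+ 2)) = cos y :> R.
  elim: m => [|m IH] in y *; first by rewrite mul0r addr0.
  by rewrite -natr1 mulrDl mul1r addrA cosD2pi.
case: (intP z) => [|m|m]; first by rewrite mul0r addr0.
  exact: cosnat.
rewrite -[x in RHS](subrK (m.+1%:R * (pi *+ 2))) cosnat.
by rewrite rmorphN /= mulNr.
Qed.

Definition cis t : R[i] := Complex (cos t) (sin t).

Lemma cis0 : cis 0 = 1.
Proof. by rewrite /cis cos0 sin0. Qed.

Lemma cisD x t : cis (x + t) = cis x * cis t.
Proof.
rewrite /cis; apply/eqP; rewrite eq_complex /= cosD sinD eqxx /=.
by rewrite [X in _ == X]addrC.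
Qed.

Lemma normc_cis t : Normc.normc (cis t) = 1.
Proof. by rewrite /= cos2Dsin2 sqrtr1. Qed.

Lemma cis_neq0 t : cis t != 0.
Proof.
apply/eqP => c0; move: (normc_cis t); rewrite c0 Normc.normc0 => /eqP.
by rewrite eq_sym oner_eq0.
Qed.

Lemma cisXz t (j : int) : cis t ^ j = cis (j%:~R * t).
Proof.
have cisXn m : cis t ^+ m = cis (m%:R * t).
  elim: m => [|m IH]; first by rewrite mul0r cis0.
  by rewrite exprS IH -cisD -natr1 mulrDl mul1r addrC.
case: (intP j) => [|m|m]; first by rewrite mul0r cis0.
  exact: cisXn.
rewrite rmorphN mulNr; apply: (mulIf (cis_neq0 (m.+1%:R * t))).
by rewrite -cisD addNr cis0 -cisXn -exprnN mulVf // cisXn cis_neq0.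
Qed.


Lemma cis_polar (z : R[i]) :
  exists t, z = Complex (Normc.normc z) 0 * cis t.
Proof.
have [->|z0] := eqVneq z 0; first by exists 0; rewrite Normc.normc0 mul0r.
case: z z0 => a b z0 /=; set r := Num.sqrt _.
have r2 : r ^+ 2 = a ^+ 2 + b ^+ 2 by rewrite sqr_sqrtr ?addr_ge0 ?sqr_ge0.
have r0 : 0 < r.
  rewrite lt_def sqrtr_ge0 andbT; apply: contra_neq z0 => r0.
  by apply: Normc.eq0_normc.
have abr : (a / r) ^+ 2 + (b / r) ^+ 2 = 1.
  by rewrite !expr_div_n -mulrDl -r2 divff // expf_neq0 ?gt_eqF.
have ar1 : -1 <= a / r <= 1.
  by rewrite -ler_norml -(@ler_pXn2r _ 2) ?nnegrE// real_normK ?num_real// expr1n; nra.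
have ca : cos (acos (a / r)) = a / r by rewrite acosK.
have sa : sin (acos (a / r)) = `|b / r|.
  by rewrite sin_acos // -abr [X in X - _]addrC addrK sqrtr_sqr.
have ra x : r * (x / r) = x by rewrite mulrC divfK ?gt_eqF.
(* The sine of an [acos] is nonnegative, so the lower half plane takes the opposite angle. *)
have [b0|b0] := leP 0 (b / r); [exists (acos (a / r)) | exists (- acos (a / r))].
  by apply/eqP; rewrite eq_complex /= ca sa (ger0_norm b0) !mul0r subr0 addr0 !ra !eqxx.
apply/eqP; rewrite eq_complex /= cosN sinN ca sa (ltr0_norm b0) opprK.
by rewrite !mul0r subr0 addr0 !ra !eqxx.
Qed.

(** Encodes that [N * x + th] is a multiple of [2 pi] without naming the integer. For [N = 0] and
    [th = 0] every [x] qualifies, which covers a vanishing first frequency. *)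
Definition aligned (N th x : R) :=
  forall u, cos (N * u + th) = cos (N * (u - x)).

Lemma aligned_grid (N th : R) (z : int) : N != 0 ->
  aligned N th (z%:~R * (pi *+ 2 / `|N|) - th / N).
Proof.
move=> N0 u; set x := (X in u - X).
have -> : N * u + th = N * (u - x) + N * (z%:~R * (pi *+ 2 / `|N|)).
  by rewrite /x; move: (_ * (_ / _)) => p; field.
have [Np|Nn] := ltP 0 N.
  rewrite (gtr0_norm Np) mulrCA (mulrC N (_ / _)) divfK //.
  exact: cos_period_int.
rewrite (ler0_norm Nn).
have -> : N * (z%:~R * (pi *+ 2 / - N)) = (- z)%:~R * (pi *+ 2).
  by rewrite mulrNz invrN mulrN mulrN mulrN mulNr mulrCA (mulrC N (_ / _)) divfK.
exact: cos_period_int.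
Qed.

Lemma aligned_around (N th t : R) : N != 0 ->
  exists x y, [/\ aligned N th x, aligned N th y, x <= t <= y
                & y - x = pi *+ 2 / `|N|].
Proof.
move=> N0; set p := pi *+ 2 / `|N|.
have p0 : 0 < p by rewrite divr_gt0 ?normr_gt0 // mulrn_wgt0 // pi_gt0.
(* The solutions form a grid of step [p] shifted by [- th / N]; the floor selects the cell that
   contains [t]. *)
have /andP[] := floor_itv ((t + th / N) / p); set z := Num.floor _ => zl zr.
exists (z%:~R * p - th / N), ((z + 1)%:~R * p - th / N).
split; [exact: aligned_grid|exact: aligned_grid| | by rewrite intrD; ring].
by rewrite lerBlDr lerBrDr -ler_pdivlMr // zl /= -ler_pdivrMr // ltW.
Qed.

(* Averaging the two values with the weights that give [x, y] mean [t] costs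
   at most the variance [(t - x) * (y - t) <= ((y - x) / 2) ^+ 2]. *)
Lemma quadratic_sum_choice m (w s : nat -> R) (x y t : R) :
    (forall k, 0 <= w k) -> x <= t <= y -> x < y ->
  exists v, (v = x \/ v = y) /\
    \sum_(k < m) w k * (v - s k) ^+ 2
      <= \sum_(k < m) w k * ((t - s k) ^+ 2 + ((y - x) / 2) ^+ 2).
Proof.
move=> w0 /andP[xt ty] xy.
pose V := \sum_(k < m) w k * ((t - s k) ^+ 2 + ((y - x) / 2) ^+ 2).
pose g v := \sum_(k < m) w k * (v - s k) ^+ 2.
have mean : g x * (y - t) + g y * (t - x) <= V * ((y - t) + (t - x)).
  rewrite mulrDr !mulr_suml -!big_split /=; apply: ler_sum => k _.
  rewrite -mulrDr -!mulrA -mulrDr; apply: ler_wpM2l; first exact: w0.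
  have : 0 <= (y - x) * ((y - t) - (t - x)) ^+ 2.
    by rewrite mulr_ge0 ?sqr_ge0 // subr_ge0 ltW.
  nra.
have yx0 : 0 < y - x by rewrite subr_gt0.
have [gxy|/ltW gyx] := leP (g x) (g y).
  exists x; split; [by left|]; rewrite -(ler_pM2r yx0) -/(g x) -/V; nra.
exists y; split; [by right|]; rewrite -(ler_pM2r yx0) -/(g y) -/V; nra.
Qed.

End RealTrigonometry.

(** The two sides differ by exactly [(p / (q * Q * M)) ^+ 2 * (M ^+ 2 - (q * Q * n) ^+ 2)]. With
    [Q = q ^+ l], the factor [p ^+ 2 / (q ^+ 2 - 1) * (1 - Q ^- 2)] is the sum of
    [p ^+ 2 * q ^- 2 ^+ i] for [1 <= i <= l], and one more term is added here. *)
Lemma variance_step (R : realFieldType) (p q Q n M : R) :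
    1 < q -> 0 < Q -> 0 <= n -> 0 < M -> q * Q * n <= M ->
  p ^+ 2 / (q ^+ 2 - 1) * (1 - Q ^- 2) + n ^+ 2 * (p *+ 2 / M / 2) ^+ 2
    <= p ^+ 2 / (q ^+ 2 - 1) * (1 - q ^- 2 * Q ^- 2).
Proof.
move=> q1 Q0 n0 M0 le_M; have q0 : 0 < q by apply: lt_trans q1.
have q2 : 1 < q ^+ 2 by rewrite exprn_egt1.
rewrite -subr_ge0 -[p *+ 2]mulr_natr.
rewrite (_ : _ - _ = (p / (q * Q * M)) ^+ 2 * (M ^+ 2 - (q * Q * n) ^+ 2)).
  rewrite mulr_ge0 ?sqr_ge0 // subr_ge0 lerXn2r // nnegrE ?(ltW M0) //.
  by rewrite !mulr_ge0 // ltW.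
by field; rewrite !gt_eqF //= subr_gt0.
Qed.

(** * Greedy choice of the points for a lacunary sequence of frequencies *)

Section Greedy.
Variables (R : realType) (N c th : nat -> R) (q : R).
Hypotheses (q1 : 1 < q) (N0 : forall k, N k.+1 != 0) (th0 : th 0%N = 0).
Hypotheses (hN : forall k, q * `|N k| <= `|N k.+1|) (c0 : forall k, 0 <= c k).

Lemma lacunary_growth k i : q ^+ i * `|N k| <= `|N (k + i)%N|.
Proof.
elim: i => [|i IH]; first by rewrite mul1r addn0.
rewrite addnS exprS -mulrA; apply: le_trans (hN _).
by rewrite ler_wpM2l // ltW // (lt_trans _ q1).
Qed.

(** Induction on [m]: each new point adds to the error at [k] a variance controlled by the next term
    of a geometric series. The weights [c k * N k ^+ 2] are those that the quadratic bound on the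
    cosine produces. *)
Lemma greedy_points m : exists s : nat -> R,
  (forall k, (k <= m)%N -> aligned (N k) (th k) (s k)) /\
  \sum_(k < m.+1) c k * N k ^+ 2 * (s m - s k) ^+ 2
    <= \sum_(k < m.+1) c k * (pi ^+ 2 / (q ^+ 2 - 1) * (1 - q ^- 2 ^+ (m - k))).
Proof.
elim: m => [|m [s [s_al s_le]]].
  exists (fun=> 0); split=> [k|].
    by rewrite leqn0 => /eqP -> u; rewrite th0 addr0 subr0.
  by rewrite !big_ord1 subnn !subrr expr0n /= !mulr0.
have [x [y [xal yal xty yx]]] := aligned_around (th m.+1) (s m) (N0 m).
have q2 : 1 < q ^+ 2 by rewrite exprn_egt1.
have xy : x < y.
  rewrite -subr_gt0 yx divr_gt0 ?normr_gt0 // mulrn_wgt0 //; exact: pi_gt0.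
have w0 k : 0 <= c k * N k ^+ 2 by rewrite mulr_ge0 ?sqr_ge0.
have [v [v_xy v_le]] := quadratic_sum_choice m.+1 s w0 xty xy.
exists (fun k => if (k <= m)%N then s k else v); split=> [k|].
  rewrite leq_eqVlt ltnS; case: (leqP k m) => [km _|km]; first exact: s_al.
  by rewrite orbF => /eqP ->; case: v_xy => ->.
(* The new index [m.+1] contributes 0 on both sides. *)
rewrite ltnn big_ord_recr [leRHS]big_ord_recr /= ltnn subnn !subrr expr0n /=.
rewrite !mulr0 !addr0.
have -> : \sum_(i < m.+1) c i * N i ^+ 2 * (v - (if (i <= m)%N then s i else v)) ^+ 2
   = \sum_(i < m.+1) c i * N i ^+ 2 * (v - s i) ^+ 2.
  by apply: eq_bigr => i _; rewrite -ltnS ltn_ord.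
apply: (le_trans v_le).
rewrite (eq_bigr _ (fun _ _ => mulrDr _ _ _)) big_split /=.
have {}s_le := lerD s_le (lexx
  (\sum_(i < m.+1) c i * N i ^+ 2 * ((y - x) / 2) ^+ 2)).
apply: (le_trans s_le); rewrite -big_split /=; apply: ler_sum => i _.
rewrite -(mulrA (c i) (N i ^+ 2)) -mulrDr; apply: ler_wpM2l => //.
have im : (i <= m)%N by rewrite -ltnS.
rewrite (subSn im) (exprS _ (m - i)); set r := _ ^+ (m - i).
have rE : r = (q ^+ (m - i)) ^- 2 by rewrite /r exprVn -!exprM mulnC.
have := lacunary_growth i (m - i).+1.
rewrite addnS subnKC // (exprS q (m - i)) => gr.
rewrite yx; set M := `|N m.+1|.
have M0 : 0 < M by rewrite normr_gt0.
have -> : N i ^+ 2 = `|N i| ^+ 2 by rewrite real_normK ?num_real.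
rewrite rE; apply: variance_step => //.
by rewrite exprn_gt0 // (lt_trans _ q1).
Qed.

Lemma lacunary_cos_sum m : exists t,
  (1 - pi ^+ 2 / (q ^+ 2 - 1) / 2) * \sum_(k < m.+1) c k
    <= \sum_(k < m.+1) c k * cos (N k * t + th k).
Proof.
have [s [s_al s_le]] := greedy_points m; exists (s m).
have q2 : 1 < q ^+ 2 by rewrite exprn_egt1.
set K := pi ^+ 2 / _ in s_le *.
have K0 : 0 <= K by rewrite divr_ge0 ?sqr_ge0 // subr_ge0 ltW.
have cosE (k : 'I_m.+1) : c k * (1 - (N k * (s m - s k)) ^+ 2 / 2)
    <= c k * cos (N k * s m + th k).
  by rewrite s_al -1?ltnS // ler_wpM2l // cos_ge_quadratic.
apply: le_trans (ler_sum _ (fun k _ => cosE k)).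
(* The partial geometric sums are bounded by the full series, which removes the dependence on
   [m - k]. *)
have D0 : \sum_(k < m.+1) c k * (K * (1 - q ^- 2 ^+ (m - k)))
    <= K * \sum_(k < m.+1) c k.
  rewrite mulr_sumr; apply: ler_sum => k _.
  rewrite mulrCA ler_wpM2l // ler_piMr // lerBlDr lerDl exprn_ge0 //.
  by rewrite invr_ge0 sqr_ge0.
have -> : \sum_(k < m.+1) c k * (1 - (N k * (s m - s k)) ^+ 2 / 2)
   = \sum_(k < m.+1) c k
     - (\sum_(k < m.+1) c k * N k ^+ 2 * (s m - s k) ^+ 2) / 2.
  rewrite mulr_suml -sumrB; apply: eq_bigr => k _.
  by rewrite exprMn; ring.
lra.
Qed.

End Greedy.

(** * From cosine sums to the supremum norm of trigonometric polynomials *)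

Section SidonBound.
Variable R : realType.
Implicit Types (G : {fset int}) (a : int -> R[i]).

Lemma normc_trig_poly_le_sup G a (z : R[i]) : unit_circle z ->
  Normc.normc (trig_poly G a z) <= sup_circle (trig_poly G a).
Proof.
move=> z1; apply: ub_le_sup; last by exists z.
(* An upper bound is required, since [sup] of an unbounded set would be 0. *)
exists (\sum_(j <- G) Normc.normc (a j)) => _ [w /complexI w1 <-].
have [t wE] := cis_polar w; rewrite {}w1 mul1r in wE.
rewrite {}wE /trig_poly; elim/big_ind2: _ => [|x1 x2 y1 y2 le1 le2|j _].
- by rewrite Normc.normc0.
- by apply: le_trans (le_normcD _ _) _; exact: lerD.
by rewrite Normc.normcM cisXz normc_cis mulr1.
Qed.

Lemma fset_in_range (n : nat -> int) G : [set` G] `<=` range n ->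
  exists m, forall j, j \in G -> exists2 k, (k < m.+1)%N & n k = j.
Proof.
move=> Gn; suff : forall s : seq int, {subset s <= G} -> exists m,
    forall j, j \in s -> exists2 k, (k < m.+1)%N & n k = j.
  by move=> /(_ (enum_fset G)); apply.
elim=> [|i s IH] sG; first by exists 0%N.
have [|m hm] := IH; first by move=> j js; apply: sG; rewrite inE js orbT.
have [k _ nk] : range n i by apply: Gn; rewrite /= sG // inE eqxx.
exists (maxn m k) => j; rewrite inE => /predU1P[->|/hm [l lm nl]].
  by exists k => //; rewrite ltnS leq_maxr.
by exists l => //; rewrite ltnS leq_max -ltnS lm.
Qed.

Lemma sum_fset_range (V : nmodType) (n : nat -> int) G m (f : int -> V) :
    injective n -> (forall j, j \in G -> exists2 k, (k < m)%N & n k = j) ->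
  \sum_(j <- G) f j = \sum_(k < m | n k \in G) f (n k).
Proof.
move=> n_inj Gm.
rewrite -(big_mkord (fun k => n k \in G) (f \o n)) -big_filter.
rewrite -(big_map n xpredT f); apply: perm_big; apply: uniq_perm.
- exact: fset_uniq.
- by rewrite map_inj_uniq // filter_uniq // iota_uniq.
move=> j; apply/idP/mapP => [jG|[k]]; last by rewrite mem_filter => /andP[kG _] ->.
have [k km nk] := Gm j jG; exists k => //.
by rewrite mem_filter nk jG mem_index_iota.
Qed.

Lemma Re_sum (I : Type) (r : seq I) (P : pred I) (F : I -> R[i]) :
  complex.Re (\sum_(i <- r | P i) F i) = \sum_(i <- r | P i) complex.Re (F i).
Proof. by apply: (big_morph _ (id1 := 0) (op1 := +%R)) => // -[? ?] [? ?]. Qed.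

Lemma Re_le_normc (z : R[i]) : complex.Re z <= Normc.normc z.
Proof.
case: z => x y /=; apply: le_trans (ler_norm x) _.
by rewrite -sqrtr_sqr ler_wsqrtr // lerDl sqr_ge0.
Qed.

Lemma lacunary_sidon (n : nat -> int) (q : R) G a : injective n -> 1 < q ->
    (forall k, q * `|n k|%:~R <= `|n k.+1|%:~R) -> [set` G] `<=` range n ->
  (1 - pi ^+ 2 / (q ^+ 2 - 1) / 2) * \sum_(j <- G) Normc.normc (a j)
    <= sup_circle (trig_poly G a).
Proof.
move=> n_inj q1 hn Gn; have q0 : 0 < q by apply: lt_trans q1.
have [m Gm] := fset_in_range Gn.
have [ph aE] := choice (fun j => cis_polar (a j)).
pose N k : R := (n k)%:~R.
(* Zero coefficients fill the gaps of [G], so that the growth condition holds between consecutive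
   indices. Subtracting [ph (n 0%N)] makes the first phase vanish. *)
pose c k := if n k \in G then Normc.normc (a (n k)) else 0.
pose th k := ph (n k) - ph (n 0%N).
have nS k : n k.+1 != 0.
  (* If [n k.+1] were 0, the growth condition would force [n k = 0] too, against injectivity. *)
  apply/eqP => nk1; have := hn k; rewrite nk1 normr0 mulr0z pmulr_rle0 //.
  rewrite lerz0 normr_le0 -nk1 => /eqP /n_inj /eqP.
  by rewrite eqn_leq ltnn andbF.
have [||||t] := @lacunary_cos_sum R N c th q q1 _ _ _ _ m.
- by move=> k; rewrite /N intr_eq0.
- by rewrite /th subrr.
- by move=> k; rewrite /N -!intr_norm.
- by move=> k; rewrite /c; case: ifP => // _; case: (a _) => ? ?; exact: sqrtr_ge0.
have -> : \sum_(j <- G) Normc.normc (a j) = \sum_(k < m.+1) c k.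
  by rewrite (sum_fset_range _ n_inj Gm) big_mkcond.
move=> /le_trans; apply.
have cis_t : unit_circle (cis t) by apply: (congr1 (real_complex R) (normc_cis t)).
apply: le_trans (normc_trig_poly_le_sup G a cis_t).
(* A unimodular factor leaves the modulus unchanged and performs the rotation built into [th]. *)
rewrite -[leRHS]mul1r -(normc_cis (- ph (n 0%N))) -Normc.normcM.
apply: le_trans (Re_le_normc _).
rewrite mulr_sumr Re_sum (sum_fset_range _ n_inj Gm) [leRHS]big_mkcond /=.
apply: ler_sum => k _; rewrite /c; case: ifP => _; last by rewrite mul0r.
rewrite {2}aE cisXz mulrCA -mulrA -!cisD.
have -> : ph (n k) + (- ph (n 0%N) + (n k)%:~R * t) = N k * t + th k.
  by rewrite /N /th; ring.
by rewrite /= mul0r subr0.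
Qed.

End SidonBound.

Theorem mainTheorem14 (R : realType) (n : nat -> int) (q : R)
    (n_inj : injective n)
    (hq : Num.sqrt (pi ^+ 2 / 2 + 1) < q)
    (hn : forall k : nat, q * `|n k|%:~R <= `|n k.+1|%:~R) :
  (sidon_constant R (range n)
     <= (1 + pi ^+ 2 / (2 * q ^+ 2 - 2 - pi ^+ 2))%:E)%E.
Proof.
have pi0 := pi_gt0 R.
have q_ge0 : 0 < q by apply: le_lt_trans hq; exact: sqrtr_ge0.
have q2 : pi ^+ 2 / 2 + 1 < q ^+ 2.
  rewrite -(@ltr_pXn2r _ 2) ?nnegrE ?sqrtr_ge0 ?(ltW q_ge0)// in hq.
  by rewrite sqr_sqrtr // in hq; rewrite addr_ge0 // divr_ge0 // sqr_ge0.
have q1 : 1 < q.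
  rewrite -(@ltr_pXn2r _ 2) ?nnegrE ?ler01 ?(ltW q_ge0)// expr1n.
  by apply: le_lt_trans q2; rewrite lerDr divr_ge0 ?sqr_ge0.
apply: ereal_inf_lbound; exists (1 + pi ^+ 2 / (2 * q ^+ 2 - 2 - pi ^+ 2)) => //.
move=> G a Gn; have := lacunary_sidon a n_inj q1 hn Gn.
set S := \sum_(j <- G) _; set U := sup_circle _.
(* This is the squared hypothesis on [q]; it makes the factor [1 - pi ^+ 2 / (q ^+ 2 - 1) / 2]
   positive, and the claimed constant is its inverse. *)
have D0 : 0 < 2 * q ^+ 2 - 2 - pi ^+ 2 by lra.
have D1 : 0 < q ^+ 2 - 1 by have := sqr_ge0 (pi : R); lra.
have -> : 1 + pi ^+ 2 / (2 * q ^+ 2 - 2 - pi ^+ 2)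
   = (1 - pi ^+ 2 / (q ^+ 2 - 1) / 2)^-1.
  move: (pi : R) D0 => p D0.
  by field; rewrite gt_eqF // gt_eqF //; lra.
rewrite ler_pdivlMl // subr_gt0 ltr_pdivrMr // ltr_pdivrMr //; lra.
Qed.
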